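(* Let $\alpha\in(0,1)$ and $\lambda>0$, let $S_{\alpha,\lambda}(t)$, $t\ge0$, be the tempered stable subordinator with index $\alpha$ and tempering parameter $\lambda$, and let $E_{\alpha,\lambda}(t)=\inf\{s\ge 0: S_{\alpha,\lambda}(s)>t\}$ be the inverse tempered stable subordinator. Then for every $t>0$ the distribution of $E_{\alpha,\lambda}(t)$ is not infinitely divisible.
   Context: A subordinator is a one-dimensional Lévy process started at $0$ with almost surely non-decreasing sample paths. The tempered stable subordinator is the subordinator with $\mathbb{E}(e^{-uS_{\alpha,\lambda}(t)})=e^{-t((u+\lambda)^\alpha-\lambda^\alpha)}$ for $u>0$, $t\ge 0$. A real random variable $X$ (or its distribution) is infinitely divisible if for each $n>1$ there exist i.i.d. random variables $X_1,\dots,X_n$ (with law depending on $n$) such that $X$ and $X_1+\cdots+X_n$ have the same distribution. *)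

(* Defs.v *)
From HB Require Import structures.
From mathcomp Require Import all_boot all_order all_algebra.
From mathcomp Require Import all_classical all_reals all_analysis.

Set Implicit Arguments.
Unset Strict Implicit.
Unset Printing Implicit Defensive.

Import Order.TTheory GRing.Theory Num.Theory.
Import numFieldNormedType.Exports.

Local Open Scope classical_set_scope.
Local Open Scope ring_scope.

(* MathComp-Analysis.  [pushforward P X B] is P (X \in B); laws are compared
   on Borel sets only, and the two variables may live on different spaces. *)
Definition same_law (R : realType)
    (d : measure_display) (T : measurableType d) (P : probability T R)
    (d' : measure_display) (T' : measurableType d') (Q : probability T' R)
    (X : T -> R) (Y : T' -> R) : Prop :=
  forall B : set R, measurable B -> pushforward P X B = pushforward Q Y B.

(* The product rule for subfamilies is the case where some B i are setT. *)
Definition mutually_independent (R : realType)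
    (d : measure_display) (T : measurableType d) (P : probability T R)
    (n : nat) (X : 'I_n -> T -> R) : Prop :=
  forall B : 'I_n -> set R, (forall i, measurable (B i)) ->
    P [set w | forall i, B i (X i w)] =
    (\prod_(i < n) P (X i @^-1` B i))%E.

(* The i.i.d. summands may live on any probability space. *)
Definition infinitely_divisible (R : realType) (mu : probability R R) : Prop :=
  forall n : nat, (1 < n)%N ->
    exists (d : measure_display) (T : measurableType d) (Q : probability T R)
      (X : 'I_n -> {RV Q >-> R}),
      [/\ mutually_independent Q (fun i => X i : T -> R),
          (forall i j, same_law Q Q (X i) (X j)) &
          (forall B : set R, measurable B ->
             mu B = pushforward Q (fun w => \sum_(i < n) X i w) B)].

(* Processes are indexed by R; only times t >= 0 are ever used.  No path
   regularity beyond stochastic continuity is required, so processes with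
   almost surely cadlag paths are covered. *)
Record levy_process (R : realType)
    (d : measure_display) (T : measurableType d) (P : probability T R)
    (S : R -> {RV P >-> R}) : Prop := {
  levy_start0 : {ae P, forall w, S 0 w = 0} ;
  levy_indep_increments : forall (n : nat) (t : nat -> R),
    0 <= t 0%N -> {homo t : i j / (i < j)%N >-> i < j} ->
    mutually_independent P
      (fun (i : 'I_n) w => S (t i.+1) w - S (t i) w) ;
  levy_stationary_increments : forall s t : R, 0 <= s -> s <= t ->
    same_law P P (fun w => S t w - S s w) (fun w => S (t - s) w - S 0 w) ;
  levy_stochastically_continuous : forall s eps : R, 0 <= s -> 0 < eps ->
    P [set w | eps < `|S t w - S s w|]
      @[t --> within [set t | 0 <= t] (nbhs s)] --> 0%E
}.

Record subordinator (R : realType)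
    (d : measure_display) (T : measurableType d) (P : probability T R)
    (S : R -> {RV P >-> R}) : Prop := {
  subordinator_levy : levy_process S ;
  subordinator_nondecreasing :
    {ae P, forall w, forall s t : R, 0 <= s -> s <= t -> S s w <= S t w}
}.

Record tempered_stable_subordinator (R : realType)
    (d : measure_display) (T : measurableType d) (P : probability T R)
    (alpha lambda : R) (S : R -> {RV P >-> R}) : Prop := {
  tempered_stable_is_subordinator : subordinator S ;
  tempered_stable_laplace : forall u t : R, 0 < u -> 0 <= t ->
    'E_P[fun w => expR (- u * S t w)]%E =
    (expR (- t * ((u + lambda) `^ alpha - lambda `^ alpha)))%:E
}.

(* Extended-real valued: +oo on the (possible) paths that never exceed t. *)
Definition inverse_process (R : realType)
    (d : measure_display) (T : measurableType d) (P : probability T R)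
    (S : R -> {RV P >-> R}) (t : R) (w : T) : \bar R :=
  ereal_inf [set s%:E | s in [set s : R | 0 <= s /\ t < S s w]].

(* Paths are monotone only almost surely, so the infimum over uncountably many
   times, and hence its law, is determined through a random variable that is
   almost surely equal to it; all such variables have the same law. *)
Definition version_of (R : realType)
    (d : measure_display) (T : measurableType d) (P : probability T R)
    (X : {RV P >-> R}) (Y : T -> \bar R) : Prop :=
  {ae P, forall w, (X w)%:E = Y w}.

(* Main.v *)
(** The law of E(t) has tails that are too light for a nonconstant infinitely
divisible law.

Let Y >= 0 be nonconstant and equal in law to a sum of n i.i.d. variables X_i.
Then X_i >= 0, and the Laplace transforms satisfy E exp(-u Y) = l(u)^n with
l(u) = E exp(-u X_i).  Hence n E (1 - exp(-X_i))^2 = n (1 - 2 l(1) + l(2)) is at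
least a constant 2c > 0 given by the variance of exp(-Y), while
n E (1 - exp(-X_i)) <= - ln E exp(-Y).  Since
(1 - exp(-x))^2 <= a (1 - exp(-x)) + 1_{x > a}, for a small and fixed one gets
P(X_i > a) >= c / n, and therefore P(Y > n a) >= (c / n)^n.

On the other hand P(E(t) > x) <= P(S(x) <= t)
<= exp(u t - x ((u + lambda)^alpha - lambda^alpha)) for all u > 0.  With u = n and
x = n a, taking n-th roots gives
c / n <= exp(t - a ((n + lambda)^alpha - lambda^alpha)), which fails for large n.
Finally E(t) is not constant since P(E(t) >= x) >= P(S(x) <= t) > 0 for all x. *)
Require Import Defs.
From HB Require Import structures.
From mathcomp Require Import all_boot all_order all_algebra.
From mathcomp Require Import all_classical all_reals all_analysis.
From mathcomp Require Import measurable_realfun ring lra.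

Import Order.TTheory GRing.Theory Num.Theory.
Import numFieldNormedType.Exports.

Local Open Scope classical_set_scope.
Local Open Scope ring_scope.

(** * Indicators and measurability of comparison sets *)

Lemma eq_indic (R : pzRingType) (T T' : Type) (A : set T) (B : set T') x y :
  (A x <-> B y) -> \1_A x = \1_B y :> R.
Proof.
move=> [AB BA]; rewrite !indicE.
have [Ax|nAx] := pselect (A x); first by rewrite !mem_set//; exact: AB.
by rewrite !memNset// => /BA.
Qed.

Lemma measurable_lt_set (R : realType) (d : measure_display)
    (T : measurableType d) (f g : T -> R) :
  measurable_fun setT f -> measurable_fun setT g ->
  measurable [set x | f x < g x].
Proof.
move=> mf mg; have : measurable_fun setT (fun x => f x < g x).
  exact: measurable_fun_ltr.
by move=> /(_ measurableT [set true]); rewrite setTI; exact.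
Qed.

Lemma measurable_le_set (R : realType) (d : measure_display)
    (T : measurableType d) (f g : T -> R) :
  measurable_fun setT f -> measurable_fun setT g ->
  measurable [set x | f x <= g x].
Proof.
move=> mf mg; have : measurable_fun setT (fun x => f x <= g x).
  exact: measurable_fun_ler.
by move=> /(_ measurableT [set true]); rewrite setTI; exact.
Qed.

(** * Layer cake formula and expectations of products of independent variables *)

(** Since [g w] is the length of [[0, g w[], both sides integrate [G] over the region under the
    graph of [g]; Tonelli swaps the order. *)
Lemma integral_mul_layer_cake (R : realType) (d : measure_display)
    (T : measurableType d) (P : probability T R) (G g : T -> R)
    (mG : measurable_fun setT G) (G0 : forall w, 0 <= G w)
    (mg : measurable_fun setT g) (g0 : forall w, 0 <= g w) :
  (\int[P]_w (G w * g w)%:E =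
   \int[lebesgue_measure]_(s in `[0%R, +oo[)
     \int[P]_w (G w * \1_[set w | (s < g w)%R] w)%:E)%E.
Proof.
pose I (p : T * measurableTypeR R) : R := \1_[set p | 0 <= p.2 < g p.1] p.
pose F (p : T * measurableTypeR R) : \bar R := (G p.1 * I p)%:E.
have mF : measurable_fun setT F.
  apply/measurable_EFinP/measurable_funM; first exact: measurableT_comp.
  apply: measurable_indic.
  rewrite (_ : mkset _ = [set p | 0 <= p.2] `&` [set p | p.2 < g p.1]).
    apply: measurableI; first exact: measurable_le_set.
    by apply: measurable_lt_set => //; exact: measurableT_comp.
  by apply/seteqP; split => p /= => [/andP//|[-> ->]].
have I0 p : 0 <= I p by rewrite /I indicE.
transitivity (\int[P]_w \int[@lebesgue_measure R]_s F (w, s))%E.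
  apply: eq_integral => w _.
  have Iw s : I (w, s) = \1_(`[0, g w[%classic) s.
    by apply: eq_indic; rewrite /= in_itv.
  transitivity (\int[@lebesgue_measure R]_s
      ((G w)%:E * (\1_(`[0%R, g w[%classic) s)%:E))%E; last first.
    by apply: eq_integral => s _; rewrite -Iw -EFinM.
  rewrite ge0_integralZl ?lee_fin//; last first.
    exact/measurable_EFinP/measurable_indic.
  rewrite EFinM; congr (_ * _)%E.
  rewrite integral_indic// setIT.
  change ((g w)%:E = lebesgue_measure (`[0%R, g w[%classic : set R)).
  rewrite lebesgue_measure_itv/= lte_fin.
  by have := g0 w; rewrite le_eqVlt => /orP[/eqP <-|->]; rewrite ?ltxx// oppr0 adde0.
have F0 p : (0 <= F p)%E by rewrite lee_fin mulr_ge0.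
transitivity (\int[@lebesgue_measure R]_s \int[P]_w F (w, s))%E.
  exact: (fubini_tonelli F mF F0).
rewrite [in RHS]integral_mkcond; apply: eq_integral => s _.
rewrite patchE; case: ifPn => s0.
  apply: eq_integral => w _; congr (_ * _)%:E.
  move: s0; rewrite inE/= in_itv/= andbT => s0.
  by apply: eq_indic; rewrite /= s0.
apply: integral0_eq => w _; rewrite /F/= /I indicE memNset ?mulr0//=.
move/negP: s0; rewrite inE/= in_itv/= andbT => s0 /andP[]. by move=> /s0.
Qed.

(* By layer cake both sides are integrals over the superlevel sets of g. *)
Lemma expectation_mul_comp (R : realType) (d : measure_display)
    (T : measurableType d) (P : probability T R) (G Y : T -> R) (g : R -> R)
    (C : \bar R) (mG : measurable_fun setT G) (G0 : forall w, 0 <= G w)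
    (mY : measurable_fun setT Y)
    (mg : measurable_fun setT g) (g0 : forall x, 0 <= g x) (C0 : (0 <= C)%E) :
  (forall B, measurable B ->
     'E_P[fun w => (G w * \1_B (Y w))%R] = C * 'E_P[fun w => (\1_B (Y w))%R])%E ->
  ('E_P[fun w => (G w * g (Y w))%R] = C * 'E_P[fun w => g (Y w)])%E.
Proof.
move=> h.
have mgY : measurable_fun setT (g \o Y) by exact: measurableT_comp.
have mB s : measurable [set x | s < g x].
  exact: measurable_lt_set.
rewrite unlock (@integral_mul_layer_cake _ _ _ _ G (g \o Y)) //; last by move=> w /=.
transitivity (C * \int[P]_w (1%R * g (Y w))%:E)%E; last first.
  by congr (_ * _)%E; apply: eq_integral => w _; rewrite mul1r.
rewrite (@integral_mul_layer_cake _ _ _ _ (cst 1) (g \o Y)) //; last by move=> w /=.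
have e s (H : T -> R) : (\int[P]_w (H w * \1_[set w | (s < g (Y w))%R] w)%:E =
    'E_P[fun w => (H w * \1_[set x | (s < g x)%R] (Y w))%R])%E by rewrite unlock.
have mP : measurable_fun setT (fun s : measurableTypeR R =>
    \int[P]_w (1%R * \1_[set w | (s < g (Y w))%R] w)%:E)%E.
  pose F (p : measurableTypeR R * T) : \bar R := (\1_[set p | p.1 < g (Y p.2)] p)%:E.
  have mF : measurable_fun setT F.
    apply/measurable_EFinP; apply: measurable_indic.
    by apply: measurable_lt_set => //; exact: (measurableT_comp mgY).
  have F0 p : (0 <= F p)%E by rewrite lee_fin.
  rewrite (_ : (fun _ => _) = (fun s => \int[P]_w F (s, w))%E).
    by apply: measurable_fun_fubini_tonelli_F.
  apply/funext => s; apply: eq_integral => w _; rewrite mul1r /F.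
  by congr EFin; exact: eq_indic.
rewrite -ge0_integralZl//=; last 2 first.
- exact: measurable_funTS.
- by move=> s _; apply: integral_ge0 => w _; rewrite mul1r lee_fin.
apply: eq_integral => s _; rewrite !e h//; congr (_ * _)%E.
by congr expectation; apply/funext => w; rewrite mul1r.
Qed.

(* The indicators of the product rule are replaced by the functions h i one
   coordinate at a time. *)
Lemma expectation_prod (R : realType) (d : measure_display)
    (T : measurableType d) (P : probability T R) (n : nat) (X : 'I_n -> T -> R)
    (mX : forall i, measurable_fun setT (X i)) (indX : mutually_independent P X)
    (h : 'I_n -> R -> R) (mh : forall i, measurable_fun setT (h i))
    (h0 : forall i x, 0 <= h i x) :
  ('E_P[fun w => (\prod_(i < n) h i (X i w))%R] =
   \prod_(i < n) 'E_P[fun w => h i (X i w)])%E.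
Proof.
have mhX (h' : 'I_n -> R -> R) i : measurable_fun setT (h' i) ->
  measurable_fun setT (fun w => h' i (X i w)) by move=> ?; exact: measurableT_comp.
(* Induction on [k]: coordinates with index at least [k] are still indicators. At [k = 0] this is
   the product rule, at [k = n] it is the claim. *)
suff H k (h' : 'I_n -> R -> R) : (forall i, measurable_fun setT (h' i)) ->
    (forall i x, 0 <= h' i x) ->
    (forall i : 'I_n, (k <= i)%N -> exists2 B, measurable B & h' i = \1_B) ->
    ('E_P[fun w => (\prod_(i < n) h' i (X i w))%R] =
     \prod_(i < n) 'E_P[fun w => h' i (X i w)])%E.
  by apply: (H n) => // i; rewrite leqNgt ltn_ord.
elim: k h' => [|k IH] h' mh' h'0 hB.
  have /choice[B /all_and2[mB hBE]] : forall i, exists B, measurable B /\ h' i = \1_B.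
    by move=> i; have [B mB e] := hB i isT; exists B.
  have mXB i : measurable (X i @^-1` B i).
    by rewrite -[X in measurable X]setTI; exact: mX.
  transitivity (P [set w | forall i, B i (X i w)]); last first.
    rewrite indX//; apply: eq_bigr => i _.
    by rewrite -expectation_indic// hBE.
  rewrite -expectation_indic; last first.
    rewrite (_ : mkset _ = \bigcap_i (X i @^-1` B i)); last first.
      by apply/seteqP; split => w /= H i; [move=> _|]; exact: H.
    exact: fin_bigcap_measurable.
  congr expectation; apply/funext => w; rewrite indicE.
  have [wB|wB] := pselect (forall i, B i (X i w)).
    rewrite mem_set// big1// => i _.
    by rewrite hBE indicE mem_set//.
  rewrite memNset//; have [i /= wi] := (existsNP _).2 wB.
  by rewrite (bigD1 i)//= hBE indicE memNset ?mul0r.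
have [kn|nk] := ltnP k n; last first.
  by apply: IH => // i ki; have := ltn_ord i; rewrite ltnNge (leq_trans nk ki).
pose j := Ordinal kn.
rewrite (bigD1 j)//= muleC.
transitivity ('E_P[fun w => ((\prod_(i | i != j) h' i (X i w)) * h' j (X j w))%R])%E.
  by congr expectation; apply/funext => w; rewrite (bigD1 j)//= mulrC.
apply: (@expectation_mul_comp _ _ _ _ _ (X j)) => //.
- under eq_fun do rewrite -big_filter.
  by apply: measurable_prod => i _; exact: mhX.
- by move=> w; apply: prodr_ge0.
- by apply: prode_ge0 => i _; exact: expectation_ge0.
move=> B mB.
(* Trading coordinate [j] for an indicator brings the product under the induction hypothesis. *)
pose h2 i := if i == j then \1_B else h' i.
have h2E i : i != j -> h2 i = h' i by rewrite /h2 => /negPf ->.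
have h2j : h2 j = \1_B by rewrite /h2 eqxx.
rewrite [RHS]muleC -h2j.
rewrite (eq_bigr (fun i => 'E_P[fun w => h2 i (X i w)])%E); last first.
  by move=> i ij; rewrite h2E.
transitivity (\prod_(i < n) 'E_P[fun w => h2 i (X i w)])%E; last by rewrite (bigD1 j).
rewrite -IH.
- congr expectation; apply/funext => w; rewrite [RHS](bigD1 j)//= mulrC.
  by congr (_ * _); apply: eq_bigr => i ij; rewrite h2E.
- by move=> i; rewrite /h2; case: ifP => // _; exact: measurable_indic.
- by move=> i x; rewrite /h2; case: ifP.
- move=> i ki; rewrite /h2; case: eqP => [_|/eqP ij]; first by exists B.
  apply: hB; rewrite ltn_neqAle ki andbT.
  by apply: contra ij => /eqP ik; apply/eqP/val_inj.
Qed.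

(** * Integrals of bounded variables and of variables with the same law *)

Lemma measurable_fun_RV (R : realType) (d : measure_display)
    (T : measurableType d) (P : probability T R) (f : T -> R) :
  measurable_fun setT f -> exists X : {RV P >-> R}, X = f :> (T -> R).
Proof.
move=> mf; pose m := isMeasurableFun.Build _ _ _ _ _ mf.
by exists (HB.pack f m : {mfun T >-> R}).
Qed.

(** Both sides integrate [f] against an image law, and the two laws agree on Borel sets. *)
Lemma same_law_Rintegral (R : realType)
    (d : measure_display) (T : measurableType d) (P : probability T R)
    (d' : measure_display) (T' : measurableType d') (Q : probability T' R)
    (X : T -> R) (Y : T' -> R) (f : R -> R) :
  measurable_fun setT X -> measurable_fun setT Y -> same_law P Q X Y ->
  measurable_fun setT f -> (forall x, 0 <= f x) ->
  \int[P]_w f (X w) = \int[Q]_w f (Y w).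
Proof.
move=> /(@measurable_fun_RV _ _ _ P)[X' <-] /(@measurable_fun_RV _ _ _ Q)[Y' <-].
move=> XY mf f0; congr fine.
have mEf : measurable_fun setT (EFin \o f) by exact/measurable_EFinP.
have f0' y : (0 <= (EFin \o f) y)%E by rewrite lee_fin.
rewrite -(@ge0_integral_distribution _ _ _ _ _ P X' (EFin \o f))//.
rewrite -(@ge0_integral_distribution _ _ _ _ _ Q Y' (EFin \o f))//.
by apply: eq_measure_integral => A mA _; exact: XY.
Qed.

Lemma bounded_RV_integrable (R : realType) (d : measure_display)
    (T : measurableType d) (P : probability T R) (f : T -> R) (M : R) :
  measurable_fun setT f -> (forall w, `|f w| <= M) ->
  P.-integrable setT (EFin \o f).
Proof.
move=> mf fM; apply: measurable_bounded_integrable => //.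
  by rewrite [X in (X < _)%E]probability_setT ltry.
by exists M; split; [exact: num_real|move=> y My w _; exact: le_trans (fM w) (ltW My)].
Qed.

(** * Positivity of the variance and inequalities for n-th roots *)

(** The difference of the two sides is the variance of [f]; were it not positive, [f] would equal
    its mean almost surely. *)
Lemma lt_sqr_Rintegral (R : realType) (d : measure_display)
    (T : measurableType d) (P : probability T R) (f : T -> R)
    (mf : measurable_fun setT f) (f0 : forall w, 0 <= f w)
    (f1 : forall w, f w <= 1) :
  ~ {ae P, forall w, f w = \int[P]_w f w} ->
  (\int[P]_w f w) ^+ 2 < \int[P]_w (f w) ^+ 2.
Proof.
set m := \int[P]_w f w => hne; rewrite ltNge; apply: contra_notN hne => hle.
have f1' w : `|f w| <= 1 by rewrite ger0_norm.
have if1 : P.-integrable setT (EFin \o f) by exact: bounded_RV_integrable f1'.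
have if2 : P.-integrable setT (EFin \o (fun w => f w ^+ 2)).
  apply: (@bounded_RV_integrable _ _ _ _ _ 1); first exact: measurable_funX.
  by move=> w; rewrite normrX exprn_ile1.
have iflin : P.-integrable setT (EFin \o (fun w => (2 * m) * f w)).
  apply: (@bounded_RV_integrable _ _ _ _ _ `|2 * m|).
    by apply: measurable_funM.
  by move=> w; rewrite normrM ler_piMr.
have ic : P.-integrable setT (EFin \o (fun w : T => m ^+ 2)).
  by apply: (@bounded_RV_integrable _ _ _ _ _ `|m ^+ 2|).
have mv : measurable_fun setT (fun w => (f w - m) ^+ 2).
  by apply: measurable_funX; exact: measurable_funB.
have iv : P.-integrable setT (EFin \o (fun w => (f w - m) ^+ 2)).
  apply: (@bounded_RV_integrable _ _ _ _ _ ((1 + `|m|) ^+ 2)) => // w.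
  by rewrite normrX lerXn2r ?nnegrE ?addr_ge0// (le_trans (ler_normB _ _))// lerD2r.
have E : \int[P]_w (f w - m) ^+ 2 = \int[P]_w (f w) ^+ 2 - m ^+ 2.
  rewrite (@eq_Rintegral _ _ _ _ _ (fun w => (f w ^+ 2 - (2 * m) * f w) + m ^+ 2));
    last by move=> w _ /=; ring.
  rewrite RintegralD//; last first.
    exact: (integrableB measurableT if2 iflin).
  rewrite RintegralB// RintegralZl// Rintegral_cst//.
  rewrite [X in fine X]probability_setT/= -/m; ring.
have Z : (\int[P]_w `|((f w - m) ^+ 2)%:E| = 0)%E.
  under eq_integral do rewrite gee0_abs ?lee_fin ?sqr_ge0//.
  rewrite -[LHS]fineK; last exact: (integrable_fin_num measurableT iv).
  congr EFin; change (\int[P]_w (f w - m) ^+ 2 = 0); apply/eqP.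
  rewrite eq_le {1}E subr_le0 hle/=; apply: Rintegral_ge0 => w _; exact: sqr_ge0.
move: Z => /(ae_eq_integral_abs _ measurableT); case; first exact/measurable_EFinP.
move=> N [mN N0 sN]; exists N; split => // w /= /eqP hw; apply: sN => /= /(_ I)/eqP.
by rewrite eqe sqrf_eq0 subr_eq0 (negbTE hw).
Qed.

(* With r := l2 / l1 ^ 2 one has 1 - 2 l1 + l2 = (1 - l1) ^ 2 + l1 ^ 2 (r - 1)
   and r - 1 >= ln r. *)
Lemma root_second_difference_ge (R : realType) (n : nat) (l1 l2 : R) :
  0 < l1 -> l1 <= 1 -> 0 < l2 -> (0 < n)%N -> (l1 ^+ n) ^+ 2 <= l2 ^+ n ->
  (l1 ^+ n) ^+ 2 * ln (l2 ^+ n / (l1 ^+ n) ^+ 2) <= n%:R * (1 - 2 * l1 + l2).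
Proof.
move=> l10 l11 l20 n0 h.
set r := l2 / l1 ^+ 2.
have l1n0 : 0 < l1 ^+ 2 by rewrite exprn_gt0.
have r0 : 0 < r by rewrite divr_gt0.
have rn : l2 ^+ n / (l1 ^+ n) ^+ 2 = r ^+ n.
  by rewrite /r expr_div_n -!exprM mulnC.
have rn1 : 1 <= r ^+ n by rewrite -rn ler_pdivlMr ?mul1r// !exprn_gt0.
have lnr0 : 0 <= ln r.
  by rewrite ln_ge0// -(@ler_pXn2r _ n) ?nnegrE ?(ltW r0)// expr1n.
rewrite rn lnXn// -(mulr_natl (ln r)) mulrCA ler_pM2l ?ltr0n//.
(* The factor [(l1 ^+ n) ^+ 2] may be enlarged to [l1 ^+ 2], because [l1 <= 1] and [ln r >= 0]. *)
apply: (@le_trans _ _ (l1 ^+ 2 * ln r)).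
  apply: ler_wpM2r => //; apply: lerXn2r; rewrite ?nnegrE ?exprn_ge0 ?(ltW l10)//.
  by rewrite -[leRHS]expr1 ler_wiXn2l// ltW.
have -> : 1 - 2 * l1 + l2 = (1 - l1) ^+ 2 + l1 ^+ 2 * (r - 1).
  by rewrite /r; field; rewrite gt_eqF.
rewrite -[leLHS]add0r lerD ?sqr_ge0// ler_pM2l//.
have := @le_ln1Dx R (r - 1); rewrite addrCA subrr addr0; apply.
by rewrite ltrBrDl subrr.
Qed.

(** This is [ln l <= l - 1] multiplied by [n]. *)
Lemma root_first_difference_le (R : realType) (n : nat) (l : R) : 0 < l ->
  n%:R * (1 - l) <= - ln (l ^+ n).
Proof.
move=> l0; rewrite lnXn// -mulNrn -(mulr_natl (- ln l)) ler_wpM2l//.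
have := @le_ln1Dx R (l - 1); rewrite addrCA subrr addr0 => h.
by rewrite lerNr opprB; apply: h; rewrite ltrBrDl subrr.
Qed.

(** * A bounded Laplace kernel on the real line *)

(** Truncation at 0 bounds the function by 1 on the whole line, so it is integrable for every law;
    on nonnegative reals it is exp(-x), which turns sums into products. *)
Definition damping {R : realType} (x : R) : R := expR (- Num.max x 0).

Lemma damping_gt0 {R : realType} (x : R) : 0 < damping x.
Proof. exact: expR_gt0. Qed.

Lemma damping_le1 {R : realType} (x : R) : damping x <= 1.
Proof. by rewrite -expR0 ler_expR oppr_le0 le_max lexx orbT. Qed.

Lemma measurable_damping (R : realType) : measurable_fun setT (@damping R).
Proof.
apply: measurableT_comp => //; apply: measurableT_comp => //.
exact: measurable_maxr.
Qed.

Lemma damping_sum (R : realType) (n : nat) (x : 'I_n -> R) :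
  (forall i, 0 <= x i) -> damping (\sum_(i < n) x i) = \prod_(i < n) damping (x i).
Proof.
move=> x0; rewrite /damping max_l ?sumr_ge0// -sumrN expR_sum.
by apply: eq_bigr => i _; rewrite max_l.
Qed.

(* On {x <= a} one has 1 - damping x <= 1 - exp (- a) <= a. *)
Lemma sqr_one_sub_damping_le (R : realType) (a x : R) : 0 < a ->
  (1 - damping x) ^+ 2 <= a * (1 - damping x) + \1_[set y | a < y] x.
Proof.
move=> a0; have d0 := damping_gt0 x; have d1 := damping_le1 x.
rewrite indicE; have [ax|xa] := ltP a x.
  rewrite mem_set// (@le_trans _ _ 1)//.
    by rewrite exprn_ile1 ?subr_ge0// gerBl ltW.
  by rewrite lerDr mulr_ge0 ?subr_ge0// ltW.
rewrite memNset/= ?ltNge ?xa// addr0 expr2 ler_wpM2r ?subr_ge0//.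
rewrite lerBlDr -lerBlDl; apply: le_trans (expR_ge1Dx _) _.
by rewrite ler_expR lerN2 ge_max xa ltW.
Qed.

(** * Lower bound for the tails of an infinitely divisible law *)

(** The constants come from the Laplace transform of [mu] at 1 and 2 only, so they serve all [n] at
    once. *)
Lemma infinitely_divisible_tail (R : realType) (mu : probability R R) :
  infinitely_divisible mu -> mu [set x | x < 0] = 0%E ->
  (forall c, mu [set c] <> 1%E) ->
  exists2 a : R, 0 < a & exists2 c : R, 0 < c & forall n, (1 < n)%N ->
    (((c / n%:R) ^+ n)%:E <= mu [set x | (n%:R * a < x)%R])%E.
Proof.
move=> hid mu0 mu1.
pose m1 : R := \int[mu]_x damping x; pose m2 : R := \int[mu]_x (damping x) ^+ 2.
have mD := @measurable_damping R.
have D0 (x : R) : 0 <= damping x by exact/ltW/damping_gt0.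
have m12 : m1 ^+ 2 < m2.
  apply: lt_sqr_Rintegral => //; first by exact: damping_le1.
  (* If [damping] were almost surely equal to [m1], then [mu], which charges no negative reals,
     would be the point mass at [- ln m1]. *)
  move=> [N [mN N0 sN]]; apply: (mu1 (- ln m1)).
  have mneg : measurable [set x : R | x < 0] by exact: measurable_lt_set.
  suff h : mu (~` [set - ln m1]) = 0%E.
    by rewrite -[[set _]]setCK probability_setC ?h ?sube0//; exact: measurableC.
  apply/eqP; rewrite -measure_le0 -N0 -(measureU0 mN mneg mu0); apply: le_measure; rewrite ?inE.
  - exact: measurableC.
  - exact: measurableU.
  - move=> x /= xc; have [x0|x0] := ltP x 0; [by right|left].
    apply: sN => /= e; apply: xc.
    by rewrite /m1 -e /damping expRK opprK max_l.
have idmp : mu.-integrable setT (EFin \o damping).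
  apply: (@bounded_RV_integrable _ _ _ _ _ 1) => // x.
  by rewrite ger0_norm// damping_le1.
have m21 : m2 <= m1.
  apply: le_Rintegral => //.
    apply: (@bounded_RV_integrable _ _ _ _ _ 1); first exact: measurable_funX.
    by move=> x; rewrite ger0_norm ?sqr_ge0// exprn_ile1// damping_le1.
  by move=> x _; rewrite expr2 ler_piMr// damping_le1.
have m1sq : m1 * m1 < m1 by rewrite -expr2 (lt_le_trans m12).
have m10 : 0 < m1.
  have : 0 <= m1 by exact: Rintegral_ge0.
  by rewrite le_eqVlt => /predU1P[e|//]; move: m1sq; rewrite -e mul0r ltxx.
have m11 : m1 <= 1 by rewrite ltW// -(ltr_pM2l m10) mulr1.
have m20 : 0 < m2 by rewrite (le_lt_trans _ m12)// sqr_ge0.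
(* With [l1 ^+ n = m1] and [l2 ^+ n = m2], the lower bound for the second difference is [2 * c]. *)
pose c := m1 ^+ 2 * ln (m2 / m1 ^+ 2) / 2.
have c0 : 0 < c.
  rewrite divr_gt0// mulr_gt0 ?exprn_gt0// ln_gt0//.
  by rewrite ltr_pdivlMr ?mul1r// exprn_gt0.
have psi0 : 0 <= - ln m1 by rewrite oppr_ge0 ln_le0.
(* Chosen so that [a * (- ln m1) <= c]; the [+ 1] makes the denominator visibly positive. *)
pose a := c / (- ln m1 + 1).
have psi1 : 0 < - ln m1 + 1 by rewrite ltr_wpDl.
have a0 : 0 < a by rewrite divr_gt0.
exists a => //; exists c => // n n1.
have n0 : (0 < n)%N by exact: ltnW.
have [d [T [Q [X [indX lawX lawY]]]]] := hid n n1.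
pose j : 'I_n := Ordinal n0.
have mX i : measurable_fun setT (X i : T -> R) by [].
have mS : measurable_fun setT (fun w => \sum_(i < n) X i w).
  exact: measurable_sum.
have mXB i B : measurable B -> measurable (X i @^-1` B).
  by move=> mB; rewrite -[X in measurable X]setTI; exact: mX.
have mSB B : measurable B -> measurable [set w | B (\sum_(i < n) X i w)].
  by move=> mB; rewrite -[X in measurable X]setTI; exact: mS.
have QX B i : measurable B -> Q (X i @^-1` B) = Q (X j @^-1` B).
  by move=> mB; exact: lawX.
have Qall B : measurable B ->
    Q [set w | forall i, B (X i w)] = ((fine (Q (X j @^-1` B))) ^+ n)%:E.
  move=> mB; rewrite (indX (fun=> B))//.
  rewrite (eq_bigr (fun=> (fine (Q (X j @^-1` B)))%:E)); last first.
    by move=> i _; rewrite QX// fineK// fin_num_measure//; exact: mXB.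
  by rewrite prodEFin prodr_const card_ord.
have mall B : measurable B -> measurable [set w | forall i, B (X i w)].
  move=> mB; rewrite (_ : mkset _ = \bigcap_i (X i @^-1` B)); last first.
    by apply/seteqP; split => w /= H i; [move=> _|]; exact: H.
  by apply: fin_bigcap_measurable => // i _; exact: mXB.
have mneg : measurable [set x : R | x < 0] by exact: measurable_lt_set.
have mtail (b : R) : measurable [set x : R | b < x] by exact: measurable_lt_set.
have hasj : has xpredT (index_enum 'I_n).
  by apply/hasP; exists j => //; rewrite mem_index_enum.
(* If all summands are negative, so is the sum, which is a null event; hence the n-th power of the
   probability that one summand is negative vanishes. *)
have X0 : {ae Q, forall w, forall i, 0 <= X i w}.
  have Qj0 : Q (X j @^-1` [set x | x < 0]) = 0%E.
    have : (Q [set w | forall i, (X i w < 0)%R] <= 0)%E.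
      rewrite -mu0 lawY//; apply: le_measure; rewrite ?inE; [exact: (mall _ mneg)|exact: (mSB _ mneg)|].
      move=> w /= h; apply: lt_le_trans (ltr_sum hasj (fun i _ => h i)) _.
      by rewrite big1.
    rewrite (Qall _ mneg) lee_fin => h.
    have q0 : 0 <= fine (Q (X j @^-1` [set x | x < 0])) by exact: fine_ge0.
    have /eqP : fine (Q (X j @^-1` [set x | x < 0])) ^+ n = 0.
      by apply/eqP; rewrite eq_le h exprn_ge0.
    rewrite expf_eq0 n0/= => /eqP e0.
    by rewrite -[LHS]fineK ?e0// fin_num_measure//; exact: mXB.
  apply: filter_forall => i; exists (X i @^-1` [set x | x < 0]); split.
  - exact: mXB.
  - by rewrite QX.
  - by move=> w /= /negP; rewrite -ltNge.
have lawid : same_law mu Q idfun (fun w => \sum_(i < n) X i w) by move=> B /lawY.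
pose l1 := \int[Q]_w damping (X j w); pose l2 := \int[Q]_w (damping (X j w)) ^+ 2.
(* Used for [damping] and its square, that is, for the Laplace transform at 1 and 2. The summands
   are only almost surely nonnegative, so the product formula for [h] is applied almost
   everywhere. *)
have key (h : R -> R) : measurable_fun setT h -> (forall x, 0 <= h x) -> (forall x, h x <= 1) ->
   (forall x : 'I_n -> R, (forall i, 0 <= x i) -> h (\sum_(i < n) x i) = \prod_(i < n) h (x i)) ->
   \int[mu]_x h x = (\int[Q]_w h (X j w)) ^+ n.
  move=> mh h0 h1 hprod.
  have mhX i : measurable_fun setT (fun w => h (X i w)) by exact: measurableT_comp.
  rewrite (@same_law_Rintegral _ _ _ mu _ _ Q idfun _ h (@measurable_id _ _ _) mS lawid)//.
  have EX i : 'E_Q[fun w => h (X i w)]%E = (\int[Q]_w h (X j w))%:E.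
    rewrite -(@same_law_Rintegral _ _ _ Q _ _ Q (X i) (X j) h (mX i) (mX j) (lawX i j))//.
    rewrite unlock /Rintegral fineK//; apply: (integrable_fin_num measurableT).
    by apply: (@bounded_RV_integrable _ _ _ _ _ 1) => // w; rewrite ger0_norm.
  have := expectation_prod _ _ _ _ _ X mX indX (fun=> h) (fun=> mh) (fun=> h0).
  rewrite (eq_bigr (fun=> (\int[Q]_w h (X j w))%:E)); last by move=> i _; exact: EX.
  rewrite prodEFin prodr_const card_ord unlock => /(congr1 fine)/= <-.
  congr fine; apply: ae_eq_integral => //.
  - by apply/measurable_EFinP; exact: measurableT_comp.
  - by apply/measurable_EFinP; apply: measurable_prod => i _.
  - by apply: filterS X0 => w hw _; rewrite hprod.
have e1 : m1 = l1 ^+ n.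
  by apply: key => //; [exact: damping_le1|exact: damping_sum].
have e2 : m2 = l2 ^+ n.
  apply: (key (fun x => (damping x) ^+ 2)); first exact: measurable_funX.
  - by move=> x; exact: sqr_ge0.
  - by move=> x; rewrite exprn_ile1// damping_le1.
  - by move=> x x0; rewrite damping_sum// prodrXl.
have mDX : measurable_fun setT (fun w => damping (X j w)) by exact: measurableT_comp.
have l10 : 0 < l1.
  have : 0 <= l1 by exact: Rintegral_ge0.
  by rewrite le_eqVlt => /predU1P[l0|//]; move: m10; rewrite e1 -l0 expr0n gtn_eqF// ltxx.
have l20 : 0 < l2.
  have : 0 <= l2 by apply: Rintegral_ge0 => w _; exact: sqr_ge0.
  by rewrite le_eqVlt => /predU1P[l0|//]; move: m20; rewrite e2 -l0 expr0n gtn_eqF// ltxx.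
have l11 : l1 <= 1 by rewrite -(@ler_pXn2r _ n) ?nnegrE ?(ltW l10)// expr1n -e1.
have h1 := @root_first_difference_le R n _ l10.
have := @root_second_difference_ge R n _ _ l10 l11 l20 n0; rewrite -e1 -e2 => /(_ (ltW m12)) h2.
rewrite -e1 in h1.
pose p := fine (Q (X j @^-1` [set x | a < x])).
(* Integrated form of the pointwise bound [sqr_one_sub_damping_le] at [X j]. *)
have hp : 1 - 2 * l1 + l2 <= a * (1 - l1) + p.
  have mone : measurable_fun setT (fun w => 1 - damping (X j w)).
    exact: measurable_funB.
  have one0 w : 0 <= 1 - damping (X j w) by rewrite subr_ge0 damping_le1.
  have one1 w : 1 - damping (X j w) <= 1 by rewrite gerBl.
  have iD : Q.-integrable setT (EFin \o (fun w => damping (X j w))).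
    apply: (@bounded_RV_integrable _ _ _ _ _ 1) => // w.
    by rewrite ger0_norm// damping_le1.
  have iD2 : Q.-integrable setT (EFin \o (fun w => damping (X j w) ^+ 2)).
    apply: (@bounded_RV_integrable _ _ _ _ _ 1); first exact: measurable_funX.
    by move=> w; rewrite ger0_norm ?sqr_ge0// exprn_ile1// damping_le1.
  have ione : Q.-integrable setT (EFin \o (fun w => 1 - damping (X j w))).
    by apply: (@bounded_RV_integrable _ _ _ _ _ 1) => // w; rewrite ger0_norm.
  have iaone : Q.-integrable setT (EFin \o (fun w => a * (1 - damping (X j w)))).
    apply: (@bounded_RV_integrable _ _ _ _ _ a); first exact: measurable_funM.
    by move=> w; rewrite ger0_norm; [exact: (ler_piMr (ltW a0))|exact: (mulr_ge0 (ltW a0))].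
  have i1 : Q.-integrable setT (EFin \o (fun=> 1 : R)).
    by apply: (@bounded_RV_integrable _ _ _ _ _ 1) => // w; rewrite normr1.
  have i2 : Q.-integrable setT (EFin \o (fun w => 2 * damping (X j w))).
    apply: (@bounded_RV_integrable _ _ _ _ _ 2); first exact: measurable_funM.
    by move=> w; rewrite ger0_norm ?mulr_ge0//; apply: ler_piMr => //; exact: damping_le1.
  have i12 : Q.-integrable setT (EFin \o (fun w => 1 - 2 * damping (X j w))).
    exact: (integrableB measurableT i1 i2).
  pose A := X j @^-1` [set x | a < x].
  have mA : measurable A by exact: mXB.
  have iA : Q.-integrable setT (EFin \o (\1_A : T -> R)).
    apply: (@bounded_RV_integrable _ _ _ _ _ 1) => // w.
    by rewrite indicE; case: (w \in A); rewrite ?normr1// normr0.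
  have Q1 : \int[Q]_w (1 : R) = 1.
    by rewrite Rintegral_cst// [X in fine X]probability_setT/= mulr1.
  have -> : 1 - 2 * l1 + l2 = \int[Q]_w (1 - damping (X j w)) ^+ 2.
    rewrite (@eq_Rintegral _ _ _ _ _ (fun w => (1 - 2 * damping (X j w)) + damping (X j w) ^+ 2));
      last by move=> w _ /=; ring.
    by rewrite RintegralD// RintegralB// RintegralZl// Q1.
  have -> : a * (1 - l1) + p = \int[Q]_w (a * (1 - damping (X j w)) + \1_A w).
    rewrite RintegralD// RintegralZl// RintegralB// Q1; congr (_ + _).
    by rewrite /p /Rintegral integral_indic// setIT.
  apply: le_Rintegral => //.
  - apply: (@bounded_RV_integrable _ _ _ _ _ 1); first exact: measurable_funX.
    by move=> w; rewrite ger0_norm ?sqr_ge0// exprn_ile1.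
  - exact: (integrableD measurableT iaone iA).
  - by move=> w _; exact: sqr_one_sub_damping_le.
have npos : 0 < n%:R :> R by rewrite ltr0n.
(* Combines [2 * c <= n * (1 - 2 * l1 + l2) <= a * n * (1 - l1) + n * p <= c + n * p]. *)
have cp : c / n%:R <= p.
  rewrite ler_pdivrMr// mulrC.
  have A : a * (n%:R * (1 - l1)) <= c.
    apply: (@le_trans _ _ (a * (- ln m1 + 1))); last by rewrite /a divfK// gt_eqF.
    rewrite ler_pM2l// (le_trans h1)// lerDl//.
  have B : 2 * c <= n%:R * (1 - 2 * l1 + l2) by rewrite /c mulrC divfK.
  have C : n%:R * (1 - 2 * l1 + l2) <= n%:R * (a * (1 - l1) + p) by rewrite ler_pM2l.
  lra.
rewrite lawY; last exact: mtail.
(* If every summand exceeds [a], the sum exceeds [n * a]; by independence the former event has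
   probability [p ^+ n]. *)
apply: (@le_trans _ _ (Q [set w | forall i, a < X i w])).
  rewrite (Qall _ (mtail a)) lee_fin lerXn2r// nnegrE; first by rewrite divr_ge0// ltW.
  exact: fine_ge0.
apply: le_measure; rewrite ?inE; [exact: (mall _ (mtail a))|exact: (mSB _ (mtail _))|].
move=> w /= h; apply: le_lt_trans (ltr_sum hasj (fun i _ => h i)).
by rewrite sumr_const card_ord mulr_natl.
Qed.

(** * Growth of powers against linear functions and logarithms *)

(* Substituting y = exp z, the claim reduces to exp ((1 - alpha) z) >= 1 + (1 - alpha) z. *)
Lemma powR_lt_linear (R : realType) (alpha lambda t x : R) :
  0 < alpha -> alpha < 1 -> 0 < lambda -> 0 < t -> 0 <= x ->
  exists2 u, 0 < u & x * (u + lambda) `^ alpha < t * u.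
Proof.
move=> al0 al1 la0 t0 x0.
pose b := t * (1 - alpha).
have b0 : 0 < b by rewrite mulr_gt0// subr_gt0.
(* The quotient by [b] makes [t * (1 + (1 - alpha) * z)] exceed [x + lambda * t]; the summand
   [lambda] ensures [lambda < expR z], so that [u = expR z - lambda] is positive. *)
pose z := (x + lambda * t) / b + lambda.
have z0 : 0 < z.
  by rewrite addr_gt0// divr_gt0// ltr_wpDl// mulr_gt0.
have lz : lambda < expR z.
  apply: lt_le_trans (expR_ge1Dx z); rewrite /z addrA ltrDr addr_gt0//.
  by rewrite divr_gt0// ltr_wpDl// mulr_gt0.
exists (expR z - lambda); first by rewrite subr_gt0.
rewrite subrK /powR gt_eqF ?expR_gt0// expRK.
have e : expR z = expR (alpha * z) * expR ((1 - alpha) * z).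
  by rewrite -expRD; congr expR; ring.
have e1 : 1 <= expR (alpha * z) by rewrite -expR0 ler_expR mulr_ge0// ltW.
have e2 : x + lambda * t < t * expR ((1 - alpha) * z).
  apply: lt_le_trans (_ : t * (1 + (1 - alpha) * z) <= _); last by rewrite ler_pM2l// expR_ge1Dx.
  have -> : t * (1 + (1 - alpha) * z) = t + b * z by rewrite /b; ring.
  have -> : b * z = x + lambda * t + b * lambda by rewrite /z mulrDr mulrCA mulfV ?gt_eqF// mulr1.
  by have := mulr_gt0 b0 la0; lra.
rewrite e; set A := expR (alpha * z) in e1 *; set B := expR _ in e2 *.
have lt0 : 0 < lambda * t by exact: mulr_gt0.
have : A * (x + lambda * t) < A * (t * B) by rewrite ltr_pM2l ?expR_gt0.
have : 1 * (lambda * t) <= A * (lambda * t) by rewrite ler_pM2r.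
lra.
Qed.

(** In terms of [y = ln n], the right side is [a * expR (alpha * y)], at least
    [a * (alpha / 2 * y) ^+ 2], and so outgrows the linear left side. *)
Lemma ln_lt_powR (R : realType) (a alpha K : R) : 0 < a -> 0 < alpha ->
  exists2 n : nat, (1 < n)%N & K + ln n%:R < a * n%:R `^ alpha.
Proof.
move=> a0 al0.
pose b := a * (alpha / 2) ^+ 2.
have b0 : 0 < b by rewrite mulr_gt0// exprn_gt0// divr_gt0.
(* For [y > Y] one has [b * y > |K| + 1] and [y > 1], whence
   [b * y ^+ 2 > (|K| + 1) * y >= K + y]. *)
pose Y := (`|K| + 1) / b + 1.
have Y1 : 1 <= Y by rewrite lerDr divr_ge0// ?ltW// addr_ge0.
pose n := (Num.bound (expR Y)).+1.
have nY : expR Y < n%:R.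
  apply: lt_le_trans (archi_boundP (expR_ge0 Y)) _.
  by rewrite ler_nat.
have n2 : 2 < n%:R :> R.
  by apply: le_lt_trans nY; apply: le_trans (expR_ge1Dx Y); lra.
have n1 : (1 < n)%N by rewrite -(ltr_nat R); lra.
exists n => //.
have np : 0 < n%:R :> R by lra.
rewrite /powR gt_eqF//; set y := ln n%:R.
have yY : Y < y by rewrite -ltr_expR lnK.
have h1 : (alpha / 2 * y) ^+ 2 <= expR (alpha * y).
  have -> : expR (alpha * y) = expR (alpha / 2 * y) ^+ 2.
    by rewrite expr2 -expRD; congr expR; field.
  have p0 : 0 <= alpha / 2 * y by rewrite mulr_ge0 ?divr_ge0 ?(ltW al0)//; lra.
  by rewrite lerXn2r ?nnegrE ?expR_ge0//; have := expR_ge1Dx (alpha / 2 * y); lra.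
have h2 : b * y ^+ 2 <= a * expR (alpha * y).
  by rewrite /b -mulrA -exprMn ler_pM2l.
apply: lt_le_trans h2.
have h3 : `|K| + 1 < b * y.
  by rewrite mulrC -ltr_pdivrMr//; move: yY; rewrite /Y; lra.
have h4 : (`|K| + 1) * y < b * y * y by rewrite ltr_pM2r//; lra.
have h5 : `|K| * 1 <= `|K| * y by rewrite ler_wpM2l//; lra.
by have := ler_norm K; rewrite expr2 mulrA; lra.
Qed.

(** * Tails of the subordinator and of its inverse *)

Lemma ae_le_measure (R : realType) (d : measure_display)
    (T : measurableType d) (P : {measure set T -> \bar R}) (A B : set T) :
  measurable A -> measurable B -> {ae P, forall w, A w -> B w} ->
  (P A <= P B)%E.
Proof.
move=> mA mB [N [mN N0 sN]]; rewrite -(measureU0 mB mN N0).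
apply: le_measure; rewrite ?inE//; first exact: measurableU.
move=> w Aw; have [Bw|nBw] := pselect (B w); first by left.
by right; apply: sN => /(_ Aw).
Qed.

Section inverse_tempered_stable.
Context (R : realType) (d : measure_display) (Omega : measurableType d)
  (P : probability Omega R) (alpha lambda : R) (S : R -> {RV P >-> R}).
Hypotheses (alpha_gt0 : 0 < alpha) (alpha_lt1 : alpha < 1)
  (lambda_gt0 : 0 < lambda) (hS : tempered_stable_subordinator alpha lambda S).

(** The Laplace exponent: [S x] has Laplace transform [expR (- x * phi u)]. *)
Let phi (u : R) : R := (u + lambda) `^ alpha - lambda `^ alpha.

Let measurable_le_time (x t : R) : measurable [set w | S x w <= t].
Proof. exact: measurable_le_set. Qed.

(** Chernoff bound: the indicator of [S x <= t] is at most [expR (u * t) * expR (- u * S x)]. *)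
Lemma tempered_stable_lower_tail (x t u : R) : 0 < u -> 0 <= x ->
  (P [set w | (S x w <= t)%R] <= (expR (u * t - x * phi u))%:E)%E.
Proof.
move=> u0 x0; rewrite -expectation_indic//.
have mX : measurable_fun setT (fun w => expR (- u * S x w)).
  by apply: measurableT_comp => //; exact: measurable_funM.
apply: (@le_trans _ _ ('E_P[fun w => (expR (u * t) * expR (- u * S x w))%R])%E).
  apply: expectation_le => //.
  - exact: measurable_funM.
  - apply: filterE => w /=; rewrite indicE.
    have [h|h] := leP (S x w) t.
      by rewrite mem_set// -expRD -expR0 ler_expR mulNr subr_ge0 ler_pM2l.
    by rewrite memNset ?mulr_ge0 ?expR_ge0//=; apply/negP; rewrite -ltNge.
rewrite unlock.
under eq_integral do rewrite EFinM.
rewrite ge0_integralZl//; last exact/measurable_EFinP.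
have := tempered_stable_laplace hS u0 x0; rewrite unlock => ->.
by rewrite -EFinM -expRD mulNr.
Qed.

(* Otherwise S x > t almost surely, and then exp (- x phi u) <= exp (- t u) for
   all u, which is impossible since phi is sublinear. *)
Lemma tempered_stable_le_gt0 (x t : R) : 0 <= x -> 0 < t ->
  (0 < P [set w | (S x w <= t)%R])%E.
Proof.
move=> x0 t0; rewrite lt0e measure_ge0 andbT; apply/eqP => h.
have [u u0] := @powR_lt_linear R _ _ _ _ alpha_gt0 alpha_lt1 lambda_gt0 t0 x0.
apply/negP; rewrite -leNgt.
have mX : measurable_fun setT (fun w => expR (- u * S x w)).
  by apply: measurableT_comp => //; exact: measurable_funM.
have : ('E_P[fun w => expR (- u * S x w)] <= 'E_P[cst (expR (- u * t))%R])%E.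
  apply: expectation_le => //.
    by move=> w; exact: expR_ge0.
  exists [set w | S x w <= t]; split => // w /= /negP.
  by rewrite -ltNge ltr_expR !mulNr ltrN2 ltr_pM2l// => /ltW.
rewrite (tempered_stable_laplace hS u0 x0) expectation_cst lee_fin ler_expR.
rewrite !mulNr lerN2 mulrC => h'.
apply: le_trans h' _; rewrite ler_wpM2l// gerBl powR_ge0//.
Qed.

Lemma inverse_process_ge0 (t : R) (w : Omega) : (0 <= inverse_process S t w)%E.
Proof. by apply/ereal_infP => _ [s [s0 _] <-]; rewrite lee_fin. Qed.

Lemma inverse_process_le (t x : R) (w : Omega) : 0 <= x -> t < S x w ->
  (inverse_process S t w <= x%:E)%E.
Proof. by move=> x0 tx; apply: ereal_inf_lbound; exists x. Qed.

(** On a nondecreasing path, [S x <= t] rules out [t < S s] for all [s] in [[0, x[]. *)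
Lemma ae_inverse_process_ge (t x : R) :
  {ae P, forall w, S x w <= t -> (x%:E <= inverse_process S t w)%E}.
Proof.
have := subordinator_nondecreasing (tempered_stable_is_subordinator hS).
apply: filterS => w mono Sxt; apply/ereal_infP => _ [s [s0 ts] <-].
rewrite lee_fin leNgt; apply/negP => sx.
by have := mono _ _ s0 (ltW sx); rewrite leNgt (le_lt_trans Sxt).
Qed.

(** If [t < S x], then [x] itself competes in the infimum, so [E] cannot exceed [x]. *)
Lemma version_gt_le (t x : R) (E : {RV P >-> R}) :
  version_of E (inverse_process S t) -> 0 <= x ->
  (P [set w | (x < E w)%R] <= P [set w | (S x w <= t)%R])%E.
Proof.
move=> hE x0; apply: ae_le_measure => //; first exact: measurable_lt_set.
apply: filterS hE => w Ew /=; rewrite -lte_fin Ew => xE.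
rewrite leNgt; apply/negP => tS.
by have := inverse_process_le _ _ _ x0 tS; rewrite leNgt xE.
Qed.

(** The law of [E] thus has unbounded support, which excludes point masses. *)
Lemma version_ge_gt0 (t x : R) (E : {RV P >-> R}) : 0 < t -> 0 <= x ->
  version_of E (inverse_process S t) -> (0 < P [set w | (x <= E w)%R])%E.
Proof.
move=> t0 x0 hE; apply: lt_le_trans (tempered_stable_le_gt0 _ _ x0 t0) _.
apply: ae_le_measure => //; first exact: measurable_le_set.
apply: filterS2 (ae_inverse_process_ge t x) hE => w h Ew /h.
by rewrite -Ew lee_fin.
Qed.

Lemma inverse_not_infinitely_divisible (t : R) (E : {RV P >-> R}) : 0 < t ->
  version_of E (inverse_process S t) ->
  ~ infinitely_divisible (distribution P E).
Proof.
move=> t0 hE hid.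
have [||a a0 [c c0 tail]] := @infinitely_divisible_tail R _ hid.
- have : (P [set w | (E w < 0)%R] <= P set0)%E.
    apply: ae_le_measure => //; first exact: measurable_lt_set.
    by apply: filterS hE => w Ew /=; rewrite -lte_fin Ew ltNge inverse_process_ge0.
  by rewrite measure0 measure_le0 => /eqP.
- move=> b hb.
  (* The event [E >= |b| + 1] has positive probability and is disjoint from [E = b]. *)
  have x0 : 0 <= `|b| + 1 by rewrite addr_ge0.
  have := version_ge_gt0 _ _ _ t0 x0 hE; apply/negP; rewrite -leNgt.
  have mEb : measurable (E @^-1` [set b]).
    by rewrite -[X in measurable X]setTI; exact: measurable_funP.
  apply: (@le_trans _ _ (P (~` (E @^-1` [set b])))).
    apply: le_measure; rewrite ?inE.
    + exact: measurable_le_set.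
    + exact: measurableC.
    + by move=> w /= h e; have := ler_norm b; rewrite e in h; lra.
  by rewrite probability_setC// [X in (_ - X)%E]hb subee.
(* [K] collects the constants left after taking logarithms in [c / n <= expR (t - a * phi n)]. *)
have [n n1] := @ln_lt_powR R a alpha (t + a * lambda `^ alpha - ln c) a0 alpha_gt0.
apply/negP; rewrite -leNgt.
have n0 : 0 < n%:R :> R by rewrite ltr0n ltnW.
have := tail n n1 => /le_trans/(_ (version_gt_le _ _ _ hE (mulr_ge0 (ltW n0) (ltW a0)))).
move=> /le_trans/(_ (tempered_stable_lower_tail _ t _ n0 (mulr_ge0 (ltW n0) (ltW a0)))).
rewrite lee_fin.
(* The choice [u = n], [x = n * a] makes the upper bound an n-th power too, so n-th roots can be
   compared. *)
have -> : n%:R * t - n%:R * a * phi n%:R = n%:R * (t - a * phi n%:R) by ring.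
rewrite expRM_natl ler_pXn2r ?nnegrE ?expR_ge0 ?divr_ge0 ?(ltW c0) ?(ltW n0)//; last exact: ltnW.
rewrite -ler_ln ?posrE ?expR_gt0 ?divr_gt0// expRK ln_div ?posrE//.
have : n%:R `^ alpha <= (n%:R + lambda) `^ alpha.
  apply: ge0_ler_powR; rewrite ?nnegrE ?(ltW alpha_gt0) ?(ltW n0)//.
    by rewrite ltW// addr_gt0.
  by rewrite lerDl ltW.
rewrite -(ler_pM2l a0) /phi mulrBr; lra.
Qed.

End inverse_tempered_stable.

(** * Existence of a real-valued measurable version of the inverse *)

(** The Chernoff bound with [u = 1] decays geometrically in [n]; hence the inverse is almost surely
    finite. *)
Lemma ae_eventually_above (R : realType) (d : measure_display)
    (Omega : measurableType d) (P : probability Omega R) (alpha lambda : R)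
    (S : R -> {RV P >-> R}) (t : R) : 0 < alpha -> 0 < lambda ->
  tempered_stable_subordinator alpha lambda S ->
  {ae P, forall w, exists n : nat, t < S n%:R w}.
Proof.
move=> alpha0 lambda0 hS; pose N := \bigcap_n [set w | S n%:R w <= t].
have mN : measurable N.
  by apply: bigcap_measurable => // n _; exact: measurable_le_set.
have NE : ~` [set w | exists n : nat, t < S n%:R w] `<=` N.
  by move=> w /= h n _ /=; rewrite leNgt; apply/negP => tS; apply: h; exists n.
exists N; split => //.
have PN n : (P N <= (expR (1 * t - n%:R * ((1 + lambda) `^ alpha - lambda `^ alpha)))%:E)%E.
  apply: le_trans (tempered_stable_lower_tail _ _ _ _ _ _ _ hS _ _ _ ltr01 (ler0n _ n)).
  by apply: le_measure; rewrite ?inE//; [exact: measurable_le_set|move=> w; exact].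
set k := _ `^ _ - _ in PN.
have k0 : 0 < k.
  by rewrite subr_gt0 gt0_ltr_powR ?nnegrE ?ltrDr// ltW// addr_gt0.
have Nfin : P N \is a fin_num by exact: fin_num_measure.
rewrite -(fineK Nfin); congr EFin; apply/eqP; rewrite eq_le fine_ge0// andbT leNgt.
apply/negP => p0.
(* At time [x] the bound [expR (t - x * k)] equals the supposedly positive [P N]; any integer beyond
   [x] contradicts it. *)
pose x := (t - ln (fine (P N))) / k.
have := PN (Num.bound `|x|); rewrite -(fineK Nfin) lee_fin leNgt => /negP; apply.
rewrite -[ltRHS]lnK// ltr_expR mul1r ltrBlDl -ltrBlDr -ltr_pdivrMr//.
exact: le_lt_trans (ler_norm _) (archi_boundP (normr_ge0 _)).
Qed.

(** By monotonicity, rationals slightly above an admissible time are admissible; a countable infimum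
    is what measurability requires. *)
Lemma inverse_process_rat (R : realType) (d : measure_display)
    (Omega : measurableType d) (P : probability Omega R)
    (S : R -> {RV P >-> R}) (t : R) (w : Omega) :
  (forall s u : R, 0 <= s -> s <= u -> S s w <= S u w) ->
  inverse_process S t w = ereal_inf [set (ratr q)%:E | q in
    [set q : rat | 0 <= ratr q :> R /\ t < S (ratr q) w]].
Proof.
move=> mono; apply/eqP; rewrite eq_le; apply/andP; split; apply/ereal_infP => _ [s [s0 ts] <-].
  by apply: ereal_inf_lbound; exists (ratr s).
apply/lee_addgt0Pr => e e0.
have [q] : exists q : rat, ratr q \in `]s, (s + e)[.
  by apply: rat_in_itvoo; rewrite ltrDl.
rewrite in_itv/= => /andP[sq qe].
apply: (@le_trans _ _ (ratr q)%:E); last by rewrite -EFinD lee_fin ltW.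
apply: ereal_inf_lbound; exists q => //; split; first exact: le_trans s0 (ltW sq).
exact: lt_le_trans ts (mono _ _ s0 (ltW sq)).
Qed.

Lemma inverse_version_exists (R : realType) (d : measure_display)
    (Omega : measurableType d) (P : probability Omega R) (alpha lambda : R)
    (S : R -> {RV P >-> R}) (t : R) : 0 < alpha -> 0 < lambda ->
  tempered_stable_subordinator alpha lambda S ->
  exists E : {RV P >-> R}, version_of E (inverse_process S t).
Proof.
move=> alpha0 lambda0 hS.
(* Enumerates the rationals through their codes; the value [+oo] for non-codes and inadmissible
   rationals leaves the infimum unchanged. *)
pose f (n : nat) (w : Omega) : \bar R :=
  if unpickle n is Some q then
    if (0 <= ratr q :> R) && (t < S (ratr q) w) then (ratr q)%:E else +oo%E
  else +oo%E.
have mf n : measurable_fun setT (f n).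
  rewrite /f; case: unpickle => [q|//].
  apply: measurable_fun_ifT => //; apply: measurable_and => //.
  exact: measurable_fun_ltr.
(* [fine] sends infinite values to 0, which alters the infimum only on a null set. *)
pose g (w : Omega) : R := fine (einfs (f ^~ w) 0%N).
have mg : measurable_fun setT g.
  by apply: measurableT_comp => //; exact: measurable_fun_einfs.
have [E EE] := measurable_fun_RV _ _ _ P _ mg.
exists E; rewrite /version_of EE.
have mono := subordinator_nondecreasing (tempered_stable_is_subordinator hS).
apply: filterS2 mono (ae_eventually_above _ _ _ _ _ _ _ t alpha0 lambda0 hS) => w mono [n tS].
have Ifin : inverse_process S t w \is a fin_num.
  rewrite ge0_fin_numE ?inverse_process_ge0//.
  by apply: le_lt_trans (inverse_process_le _ _ _ _ _ _ _ _ (ler0n _ n) tS) (ltry _).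
suff e : einfs (f ^~ w) 0%N = inverse_process S t w by rewrite /g e fineK.
rewrite inverse_process_rat// /einfs; apply/eqP; rewrite eq_le; apply/andP; split.
  apply/ereal_infP => _ [q [q0 tq] <-]; apply: ereal_inf_lbound.
  by exists (pickle q) => //; rewrite /f pickleK q0 tq.
apply/ereal_infP => _ [k _ <-]; rewrite /f.
case: unpickle => [q|]; last exact: leey.
case: ifPn => [/andP[q0 tq]|_]; last exact: leey.
by apply: ereal_inf_lbound; exists q.
Qed.

(** The existence of a version keeps the statement about all versions from being vacuous. *)
Theorem proposition3p2 (R : realType)
    (d : measure_display) (Omega : measurableType d) (P : probability Omega R)
    (alpha lambda : R) (S : R -> {RV P >-> R})
    (halpha0 : 0 < alpha) (halpha1 : alpha < 1) (hlambda : 0 < lambda)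
    (hS : tempered_stable_subordinator alpha lambda S)
    (t : R) (ht : 0 < t) :
  (exists E : {RV P >-> R}, version_of E (inverse_process S t)) /\
  (forall E : {RV P >-> R}, version_of E (inverse_process S t) ->
     ~ infinitely_divisible (distribution P E)).
Proof.
split; first exact: inverse_version_exists hS.
move=> E; exact: inverse_not_infinitely_divisible hS _ _ ht.
Qed.
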